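(* Let $G=H+3=K+L+3$ be a simple loony endgame, where $3$ denotes a 3-chain, $H=K+L$ is non-empty and composed entirely of disjoint loops (of even length at least 4), and $L$ is a loop of smallest length in $H$. Then the following move in $G$ is optimal: - if $v(H)=2$, open the 3-chain; - if $v(H)\ne2$, $L$ is a 6-loop and $v(K)=2$, open the 3-chain; - in all other cases, open $L$.
   Context: Game. A dots and boxes game (position) $G$ consists of a finite set of unclaimed boxes and a finite set of undrawn lines, each undrawn line bordering either exactly one box or exactly two distinct boxes, each box being bordered by at least one and at most four undrawn lines. Two players play. The player to move draws (removes) an undrawn line; every box none of whose bordering lines is still undrawn is then claimed by that player. If the move claims at least one box the same player must move again (if a line remains); otherwise the other player moves. Claiming a box when possible is not compulsory. The game ends when no line remains. Each player maximises (own boxes) minus (opponent's boxes), counting only boxes claimed from $G$ onwards. Value. $v(G)$ is the net score, under optimal play, of the player who is NOT to move in $G$. Equivalently, $v(G)=0$ if $G$ has no undrawn lines, and otherwise $v(G)=\min_m v(G;m)$ over undrawn lines $m$, where, if drawing $m$ claims $k$ boxes and leaves the position $G_m$, then $v(G;m)=v(G_m)-k$ if $k\ge1$ and $v(G;m)=-v(G_m)$ if $k=0$. A move $m$ is optimal if $v(G;m)=v(G)$. Chains and loops. $G+H$ is the disjoint union. An $n$-chain (denoted $n$) has boxes $b_1,\dots,b_n$ and lines $e_0,\dots,e_n$, where $e_i$ borders $b_i,b_{i+1}$ for $1\le i\le n-1$, $e_0$ borders only $b_1$ and $e_n$ borders only $b_n$. An $n$-loop ($n\ge4$, denoted $n_\ell$)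 has boxes $b_1,\dots,b_n$ and lines $e_1,\dots,e_n$, $e_i$ bordering $b_i,b_{i+1}$ (indices mod $n$). A simple loony endgame is a finite (possibly empty) disjoint union of chains of length at least 3 and loops of even length at least 4. Opening a component $Z$ of it means drawing a line of $Z$; $v(G;Z)$ denotes $v(G;m)$ for any line $m$ of $Z$ (it does not depend on the line). *)

(* Defs.v *)
From HB Require Import structures.
From mathcomp Require Import all_boot all_order all_algebra.
Set Implicit Arguments.
Unset Strict Implicit.
Unset Printing Implicit Defensive.
Import Order.TTheory GRing.Theory Num.Theory.

(* A position: [box] are the unclaimed boxes, [line] the undrawn lines. *)
Record game := Game {
  box : finType;
  line : finType;
  border : line -> {set box};
  border_card : forall m, 0 < #|border m| <= 2;
  box_degree : forall b, 0 < #|[set m | b \in border m]| <= 4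
}.

Section Play.
Variable G : game.
Implicit Types (S : {set line G}) (m : line G).

(* The positions reachable from G are represented by their set S of undrawn
   lines; the unclaimed boxes are those bordered by some line of S. *)
Definition unclaimed S : {set box G} :=
  [set b | [exists m in S, b \in border m]].

Definition captures S m : nat := #|unclaimed S :\: unclaimed (S :\ m)|.

(* Value of drawing m in S, where x is the value of the resulting position. *)
Definition after_move S m (x : int) : int :=
  let k := captures S m in if 0 < k then (x - k%:Z)%R else (- x)%R.

(* The default value of the iterated minimum is one of the minimised values,
   so this is the minimum over S. *)
Fixpoint value_rec (n : nat) S : int :=
  if n is n'.+1 then
    let F m := after_move S m (value_rec n' (S :\ m)) in
    if [pick m in S] is Some m0 then \big[Order.min/F m0]_(m in S) F m else 0%R
  else 0%R.

Definition value S : int := value_rec #|S| S.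

Definition move_value S m : int := after_move S m (value (S :\ m)).

Lemma value0 : value set0 = 0%R.
Proof. by rewrite /value cards0. Qed.

Lemma value_min S : S != set0 ->
  (exists2 m, m \in S & value S = move_value S m) /\
  (forall m, m \in S -> (value S <= move_value S m)%R).
Proof.
case/set0Pn => m0 m0S.
have cardS m : m \in S -> #|S| = #|S :\ m|.+1 by move=> mS; rewrite (cardsD1 m) mS.
have valE : exists2 m1, m1 \in S &
    value S = \big[Order.min/move_value S m1]_(m in S) move_value S m.
  rewrite /value (cardsD1 m0) m0S add1n /=.
  case: pickP => [m1 m1S|/(_ m0)]; last by rewrite m0S.
  have E m : m \in S ->
      after_move S m (value_rec #|S :\ m0| (S :\ m)) = move_value S m.
    move=> mS; rewrite /move_value /value; congr (after_move _ _ (value_rec _ _)).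
    by apply: succn_inj; rewrite -!cardS.
  by exists m1 => //; rewrite E //; apply: eq_bigr.
case: valE => m1 m1S ->; split; last by move=> m mS; apply: bigmin_le_cond.
elim/big_ind: _ => [|x y [mx mxS ->] [my myS ->]|m mS].
- by exists m1.
- by rewrite minElt; case: ifP => _; [exists mx | exists my].
- by exists m.
Qed.

End Play.

Definition v (G : game) : int := value [set: line G].

Definition v_move (G : game) (m : line G) : int := move_value [set: line G] m.

Definition optimal_move (G : game) (m : line G) : Prop := v_move m = v G.

Section Empty.
Let bd (m : void) : {set void} := set0.
Fact empty_border m : 0 < #|bd m| <= 2. Proof. by case: m. Qed.
Fact empty_degree b : 0 < #|[set m | b \in bd m]| <= 4. Proof. by case: b. Qed.
Definition empty_game : game := Game empty_border empty_degree.
End Empty.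

Section Union.
Variables G H : game.
Definition union_bd (m : line G + line H) : {set box G + box H} :=
  match m with
  | inl e => [set inl b | b in border e]
  | inr e => [set inr b | b in border e]
  end.
Fact union_border m : 0 < #|union_bd m| <= 2.
Proof.
by case: m => m /=; rewrite card_imset; [exact: border_card | exact: inl_inj |
  exact: border_card | exact: inr_inj].
Qed.
Fact union_degree b : 0 < #|[set m | b \in union_bd m]| <= 4.
Proof.
case: b => b.
- suff -> : [set m | inl b \in union_bd m] = [set inl m | m in [set m | b \in border m]].
    by rewrite card_imset; [exact: box_degree | exact: inl_inj].
  apply/setP => -[] m; rewrite !inE /=.
  + by rewrite !mem_imset ?inE //; exact: inl_inj.
  + by apply/imsetP/imsetP => -[].
- suff -> : [set m | inr b \in union_bd m] = [set inr m | m in [set m | b \in border m]].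
    by rewrite card_imset; [exact: box_degree | exact: inr_inj].
  apply/setP => -[] m; rewrite !inE /=.
  + by apply/imsetP/imsetP => -[].
  + by rewrite !mem_imset ?inE //; exact: inr_inj.
Qed.
Definition union : game := Game union_border union_degree.
End Union.

(* Boxes are numbered from 0: line e_i borders boxes i - 1 and i, when these
   exist. *)
Section Chain.
Variable n : nat.
Hypothesis n_gt0 : 0 < n.
Definition chain_bd (e : 'I_n.+1) : {set 'I_n} :=
  [set b : 'I_n | (e == b :> nat) || (e == b.+1 :> nat)].
Fact chain_border e : 0 < #|chain_bd e| <= 2.
Proof.
apply/andP; split.
  apply/card_gt0P; case: (ltnP e n) => [en|ne].
    by exists (Ordinal en); rewrite inE eqxx.
  have en : e.-1 < n by rewrite prednK ?(leq_trans n_gt0) // -ltnS.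
  by exists (Ordinal en); rewrite inE /= prednK ?eqxx ?orbT // (leq_trans n_gt0).
rewrite cardE -(size_map val) -[2]/(size [:: val e; (val e).-1]).
apply: uniq_leq_size; first by rewrite map_inj_uniq ?enum_uniq //; exact: val_inj.
move=> x /mapP[b]; rewrite mem_enum !inE => /orP[] /eqP be ->.
  by rewrite /= be eqxx.
by rewrite /= be /= eqxx orbT.
Qed.
Fact chain_degree b : 0 < #|[set e | b \in chain_bd e]| <= 4.
Proof.
apply/andP; split.
  by apply/card_gt0P; exists (widen_ord (leqnSn n) b); rewrite !inE /= eqxx.
apply: (@leq_trans #|[set widen_ord (leqnSn n) b; lift ord0 b]|).
  apply: subset_leq_card; apply/subsetP => e; rewrite !inE.
  by case/orP => h; apply/orP; [left | right]; rewrite -val_eqE.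
by rewrite cards2; case: (_ != _).
Qed.
Definition chain : game := Game chain_border chain_degree.
End Chain.

(* [ordS] is the successor modulo n. *)
Section Loop.
Variable n : nat.
Definition loop_bd (e : 'I_n) : {set 'I_n} := [set e; ordS e].
Fact loop_border e : 0 < #|loop_bd e| <= 2.
Proof. by rewrite cards2; case: (_ != _). Qed.
Fact loop_degree b : 0 < #|[set e | b \in loop_bd e]| <= 4.
Proof.
apply/andP; split; first by apply/card_gt0P; exists b; rewrite !inE eqxx.
apply: (@leq_trans #|[set b; ord_pred b]|).
  apply: subset_leq_card; apply/subsetP => e; rewrite !inE.
  by case/orP => /eqP ->; rewrite ?eqxx // ordSK eqxx orbT.
by rewrite cards2; case: (_ != _).
Qed.
Definition loop : game := Game loop_border loop_degree.
End Loop.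

Definition chain3 : game := @chain 3 isT.

(* The disjoint union of loops with the given lengths. *)
Definition loops (s : seq nat) : game :=
  foldr (fun n => union (loop n)) empty_game s.

(* Admissible lengths of the loops of a simple loony endgame. *)
Definition loop_length (n : nat) : bool := (4 <= n) && ~~ odd n.

(* Main.v *)
Require Import Defs.
From mathcomp Require Import all_boot all_order all_algebra.
From mathcomp Require Import zify.

(* Once a component with n boxes is opened, the opponent either takes all of it
   and moves in the rest D, scoring n - v(D), or takes all but the last d boxes
   (d = 2 for a chain, d = 4 for a loop) and hands over the turn, scoring
   n - 2d + v(D).  Nothing else is better, so opening it is worth
   n - d + |v(D) - d|.  By this formula the value changes by at most b - a when
   a loop of length a is replaced by one of length b >= a, hence the smallest
   loop is the best loop to open, and only L and the 3-chain have to be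
   compared.  With x = v(K), which is even, and y = v(K+3), which is odd and at
   most 1 + |x - 2|, this is a short case analysis on l; it uses that a sum of
   loops of length at least 8 never has value 4. *)

Import Order.TTheory GRing.Theory Num.Theory.

Set Implicit Arguments.
Unset Strict Implicit.
Unset Printing Implicit Defensive.

(** * Positions of a single game *)

Section Positions.
Variable G : game.
Implicit Types (S : {set line G}) (m : line G).

Lemma unclaimedP S b :
  reflect (exists2 m, m \in S & b \in border m) (b \in unclaimed S).
Proof.
rewrite inE; apply: (iffP existsP) => [[m /andP[]]|[m mS bm]]; first by exists m.
by exists m; rewrite mS.
Qed.

Lemma unclaimedS S S' : S \subset S' -> unclaimed S \subset unclaimed S'.
Proof.
move=> sSS'; apply/subsetP => b /unclaimedP[m mS bm].
by apply/unclaimedP; exists m => //; apply: (subsetP sSS').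
Qed.

Lemma unclaimed0 : unclaimed (set0 : {set line G}) = set0.
Proof. by apply/setP => b; rewrite in_set0; apply/negbTE/unclaimedP => -[m]; rewrite inE. Qed.

Lemma card_unclaimed S m : #|unclaimed S| = captures S m + #|unclaimed (S :\ m)|.
Proof.
rewrite -(cardsID (unclaimed (S :\ m)) (unclaimed S)) addnC; congr (_ + _).
by rewrite (setIidPr _) // unclaimedS // subD1set.
Qed.

Lemma captures_gt0 S m b : m \in S -> b \in border m ->
  (forall m', m' \in S -> b \in border m' -> m' = m) -> 0 < captures S m.
Proof.
move=> mS bm uniq_m; apply/card_gt0P; exists b; rewrite inE; apply/andP; split.
  apply/unclaimedP => -[m']; rewrite !inE => /andP[m'm m'S] bm'.
  by rewrite (uniq_m m') ?eqxx in m'm.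
by apply/unclaimedP; exists m.
Qed.

Lemma captures0 S m :
  (forall b, b \in border m -> b \in unclaimed (S :\ m)) -> captures S m = 0.
Proof.
move=> other; apply/eqP; rewrite cards_eq0 setD_eq0; apply/subsetP => b.
case/unclaimedP => m' m'S bm'; case: (eqVneq m' m) => [E|m'm].
  by apply: other; rewrite -E.
by apply/unclaimedP; exists m' => //; rewrite !inE m'm.
Qed.

Lemma captures0_other S m b : captures S m = 0 -> m \in S -> b \in border m ->
  exists2 m', m' \in S :\ m & b \in border m'.
Proof.
move=> /eqP; rewrite cards_eq0 setD_eq0 => /subsetP sub mS bm.
by apply/unclaimedP/sub/unclaimedP; exists m.
Qed.

Lemma move_valueE S m : move_value S m =
  if 0 < captures S m then (value (S :\ m) - (captures S m)%:Z)%R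
  else (- value (S :\ m))%R.
Proof. by []. Qed.

Lemma value_le_capture S m : m \in S -> 0 < captures S m ->
  (value S <= value (S :\ m) - (captures S m)%:Z)%R.
Proof.
move=> mS cm; have S0 : S != set0 by apply/set0Pn; exists m.
by have := (value_min S0).2 m mS; rewrite move_valueE cm.
Qed.

Lemma value_le_quiet S m : m \in S -> captures S m = 0 ->
  (value S <= - value (S :\ m))%R.
Proof.
move=> mS cm; have S0 : S != set0 by apply/set0Pn; exists m.
by have := (value_min S0).2 m mS; rewrite move_valueE cm.
Qed.

Lemma value_ind_ge S (x : int) : S != set0 ->
  (forall m, m \in S -> (x <= move_value S m)%R) -> (x <= value S)%R.
Proof. by move=> S0 h; have [[m mS ->] _] := value_min S0; apply: h. Qed.

End Positions.

(** * Values under an injective embedding of one game in another *)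

Section Embedding.
Variables (G H : game) (f : line G -> line H) (g : box G -> box H).
Implicit Types (S : {set line G}) (m : line G).
Hypothesis f_inj : injective f.
Hypothesis g_inj : injective g.
Hypothesis border_fg : forall m, border (f m) = g @: border m.

Lemma unclaimed_embed S : unclaimed (f @: S) = g @: unclaimed S.
Proof.
apply/setP => b; apply/unclaimedP/imsetP => [[_ /imsetP[m mS ->]]|].
  rewrite border_fg => /imsetP[x xm ->]; exists x => //.
  by apply/unclaimedP; exists m.
case=> x /unclaimedP[m mS xm] ->; exists (f m); first exact: imset_f.
by rewrite border_fg imset_f.
Qed.

Lemma imsetD1_inj S m : f @: S :\ f m = f @: (S :\ m).
Proof.
apply/setP => x; rewrite in_setD1; apply/andP/imsetP => [[xm /imsetP[y yS E]]|].
  by exists y => //; rewrite in_setD1 yS andbT; apply: contraNneq xm => <-; rewrite E.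
case=> y /setD1P[ym yS] ->; split; last exact: imset_f.
by rewrite (inj_eq f_inj).
Qed.

Lemma captures_embed S m : captures (f @: S) (f m) = captures S m.
Proof.
have := card_unclaimed (f @: S) (f m).
rewrite imsetD1_inj !unclaimed_embed !card_imset // (card_unclaimed S m).
by move/eqP; rewrite eqn_add2r => /eqP.
Qed.

(** Captures and successor positions correspond under [f], so induction on the number of lines gives
    equal minima. Injections cover both the inclusion of a summand in a union and isomorphisms. *)
Lemma value_embed S : value (f @: S) = value S.
Proof.
have [n le_n] := ubnP #|S|; elim: n => // n IHn in S le_n *.
have [->|S0] := eqVneq S set0; first by rewrite imset0 !value0.
have E m : m \in S -> move_value (f @: S) (f m) = move_value S m.
  move=> mS; rewrite !move_valueE captures_embed imsetD1_inj IHn //.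
  by move: le_n; rewrite (cardsD1 m) mS.
have fS0 : f @: S != set0 by rewrite imset_eq0.
apply/eqP; rewrite eq_le; apply/andP; split; apply: value_ind_ge => //.
  by move=> m mS; rewrite -E //; apply: (value_min fS0).2; apply: imset_f.
by move=> _ /imsetP[m mS ->]; rewrite E //; apply: (value_min S0).2.
Qed.

Lemma move_value_embed S m : move_value (f @: S) (f m) = move_value S m.
Proof. by rewrite !move_valueE captures_embed imsetD1_inj value_embed. Qed.

End Embedding.

(** * Positions of a disjoint union *)

Section UnionPositions.
Variables C D : game.
Implicit Types (A : {set line C}) (B : {set line D}).

Definition join A B : {set line (union C D)} := (inl @: A) :|: (inr @: B).

Lemma mem_join_inl A B m : ((inl m : line (union C D)) \in join A B) = (m \in A).
Proof.
rewrite inE mem_imset; last exact: inl_inj.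
by case: (m \in A) => //=; apply/negbTE/imsetP => -[].
Qed.

Lemma mem_join_inr A B m : ((inr m : line (union C D)) \in join A B) = (m \in B).
Proof.
rewrite inE orbC mem_imset; last exact: inr_inj.
by case: (m \in B) => //=; apply/negbTE/imsetP => -[].
Qed.

Lemma joinD1l A B m : join A B :\ inl m = join (A :\ m) B.
Proof.
by apply/setP => -[x|x]; rewrite in_setD1 ?mem_join_inl ?mem_join_inr ?in_setD1.
Qed.

Lemma joinD1r A B m : join A B :\ inr m = join A (B :\ m).
Proof.
by apply/setP => -[x|x]; rewrite in_setD1 ?mem_join_inl ?mem_join_inr ?in_setD1.
Qed.

Lemma unclaimed_join_inl A B b :
  ((inl b : box (union C D)) \in unclaimed (join A B)) = (b \in unclaimed A).
Proof.
apply/unclaimedP/unclaimedP => [[[m|m]]|[m mA bm]].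
- rewrite mem_join_inl => mA /imsetP[x xm [->]]; by exists m.
- by move=> _ /imsetP[].
- by exists (inl m); rewrite ?mem_join_inl //; apply: imset_f.
Qed.

Lemma unclaimed_join_inr A B b :
  ((inr b : box (union C D)) \in unclaimed (join A B)) = (b \in unclaimed B).
Proof.
apply/unclaimedP/unclaimedP => [[[m|m]]|[m mA bm]].
- by move=> _ /imsetP[].
- rewrite mem_join_inr => mA /imsetP[x xm [->]]; by exists m.
- by exists (inr m); rewrite ?mem_join_inr //; apply: imset_f.
Qed.

Lemma captures_join_inl A B m : captures (join A B) (inl m) = captures A m.
Proof.
rewrite /captures joinD1l -[RHS](@card_imset _ _ (@inl (box C) (box D))); last exact: inl_inj.
congr #|pred_of_set _|; apply/setP => -[b|b]; rewrite in_setD.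
  by rewrite !unclaimed_join_inl mem_imset ?in_setD //; exact: inl_inj.
by rewrite !unclaimed_join_inr andNb; apply/esym/negbTE/imsetP => -[].
Qed.

Lemma captures_join_inr A B m : captures (join A B) (inr m) = captures B m.
Proof.
rewrite /captures joinD1r -[RHS](@card_imset _ _ (@inr (box C) (box D))); last exact: inr_inj.
congr #|pred_of_set _|; apply/setP => -[b|b]; rewrite in_setD.
  by rewrite !unclaimed_join_inl andNb; apply/esym/negbTE/imsetP => -[].
by rewrite !unclaimed_join_inr mem_imset ?in_setD //; exact: inr_inj.
Qed.

Lemma value_join0 B : value (join set0 B) = value B.
Proof.
rewrite /join imset0 set0U (@value_embed D (union C D) inr inr) //; exact: inr_inj.
Qed.

Lemma joinTT : [set: line (union C D)] = join setT setT.
Proof. by apply/setP => -[x|x]; rewrite ?mem_join_inl ?mem_join_inr !inE. Qed.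

(** * Bounds on the value once one summand has been opened *)

Lemma value_join_ge A B (x : int) : A != set0 ->
  (forall m, m \in A -> 0 < captures A m ->
     (x <= value (join (A :\ m) B) - (captures A m)%:Z)%R) ->
  (forall m, m \in A -> captures A m = 0 ->
     (x <= - value (join (A :\ m) B))%R) ->
  (forall m, m \in B -> 0 < captures B m ->
     (x <= value (join A (B :\ m)) - (captures B m)%:Z)%R) ->
  (forall m, m \in B -> captures B m = 0 ->
     (x <= - value (join A (B :\ m)))%R) ->
  (x <= value (join A B))%R.
Proof.
case/set0Pn => a aA h1 h2 h3 h4; apply: value_ind_ge.
  by apply/set0Pn; exists (inl a); rewrite mem_join_inl.
case=> m; rewrite move_valueE ?mem_join_inl ?mem_join_inr.
  rewrite captures_join_inl joinD1l => mA; case: posnP => [/h2|/h1]; exact.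
rewrite captures_join_inr joinD1r => mB; case: posnP => [/h4|/h3]; exact.
Qed.

(** All of [A] can be captured without giving up the turn. Quantifying over subsets makes the
    property pass to every later position. *)
Definition takeable A := forall A', A' \subset A -> A' != set0 ->
  exists2 m, m \in A' & 0 < captures A' m.

Lemma takeableS A A' : A' \subset A -> takeable A -> takeable A'.
Proof. by move=> s tA A2 s2; apply: tA; apply: subset_trans s. Qed.

Lemma value_join_capture A B m : m \in A -> 0 < captures A m ->
  (value (join A B) <= value (join (A :\ m) B) - (captures A m)%:Z)%R.
Proof.
move=> mA cm; have := @value_le_capture _ (join A B) (inl m).
by rewrite mem_join_inl captures_join_inl joinD1l; apply.
Qed.

Lemma value_join_quiet A B m : m \in A -> captures A m = 0 ->
  (value (join A B) <= - value (join (A :\ m) B))%R.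
Proof.
move=> mA cm; have := @value_le_quiet _ (join A B) (inl m).
by rewrite mem_join_inl captures_join_inl joinD1l; apply.
Qed.

(** The player to move captures in [A] line by line, keeps the turn throughout and must then move in
    [B]. *)
Lemma take_all A B : takeable A ->
  (value (join A B) <= value B - #|unclaimed A|%:Z)%R.
Proof.
have [n le_n] := ubnP #|A|; elim: n => // n IHn in A le_n * => tA.
have [->|A0] := eqVneq A set0; first by rewrite value_join0 unclaimed0 cards0 subr0.
have [m mA cm] := tA A (subxx _) A0.
have sA : A :\ m \subset A by apply: subD1set.
have := value_join_capture B mA cm; have := card_unclaimed A m.
have := IHn (A :\ m); rewrite (cardsD1 m) mA in le_n.
by move/(_ le_n)/(_ (takeableS sA tA)); lia.
Qed.

(** The form in which the last boxes are handed over: any remaining line captures every box that it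
    borders. *)
Definition loose A := forall m b m', m \in A -> b \in border m ->
  m' \in A -> b \in border m' -> m' = m.

Lemma looseS A A' : A' \subset A -> loose A -> loose A'.
Proof.
by move=> /subsetP s lA m b m' /s mA bm /s m'A; apply: lA mA bm m'A.
Qed.

Lemma loose_captures A m : loose A -> m \in A -> 0 < captures A m.
Proof.
move=> lA mA; have /andP[/card_gt0P[b bm] _] := border_card m.
by apply: (captures_gt0 mA bm) => m' m'A; apply: lA mA bm m'A.
Qed.

Lemma loose_takeable A : loose A -> takeable A.
Proof.
move=> lA A' s /set0Pn[m mA']; exists m => //.
exact: loose_captures (looseS s lA) mA'.
Qed.

(** This matches the bound of [take_all]. Captures in either summand are handled by induction, and
    no move in [A] is quiet. After a quiet move in [B] the opponent takes all of [A], for a value of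
    at least [value B + #|unclaimed A|]. *)
Lemma loose_ge A B : loose A ->
  (value B - #|unclaimed A|%:Z <= value (join A B))%R.
Proof.
have [n le_n] := ubnP (#|A| + #|B|); elim: n => // n IHn in A B le_n * => lA.
have [->|A0] := eqVneq A set0; first by rewrite value_join0 unclaimed0 cards0 subr0.
apply: value_join_ge => // m mX cm.
- have := IHn (A :\ m) B; have := card_unclaimed A m; rewrite (cardsD1 m) mX in le_n.
  move=> -> /(_ le_n) /(_ (looseS (subD1set _ _) lA)); lia.
- by have := loose_captures lA mX; rewrite cm.
- have := IHn A (B :\ m); rewrite (cardsD1 m B) mX addnCA in le_n.
  by move=> /(_ le_n lA); have := value_le_capture mX cm; lia.
- have := take_all (B :\ m) (loose_takeable lA); have := value_le_quiet mX cm; lia.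
Qed.

(* A quiet move in [A] gives all of [A] to the opponent; a move in [B] to [B']
   is answered by taking all of [A], and then
   [- value (join A B') >= #|unclaimed A| - value B' >= #|unclaimed A| + value B]. *)
Lemma opened_ge d A B : takeable A ->
  (forall A' m, A' \subset A -> m \in A' -> captures A' m = 0 -> d <= #|unclaimed A'|) ->
  (forall m, captures B m = 0) ->
  (d%:Z - #|unclaimed A|%:Z - `|value B - d%:Z| <= value (join A B))%R.
Proof.
have [n le_n] := ubnP #|A|; elim: n => // n IHn in A le_n * => tA quiet_big qB.
have [->|A0] := eqVneq A set0; first by rewrite value_join0 unclaimed0 cards0; lia.
have sA m : A :\ m \subset A by apply: subD1set.
apply: value_join_ge => // m mX cm.
- have := IHn (A :\ m); have := card_unclaimed A m; rewrite (cardsD1 m) mX in le_n.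
  move=> -> /(_ le_n) /(_ (takeableS (sA m) tA)) h; have {h}: _ := h _ qB.
  move=> h; have {h}: _ := h (fun A' m' s => quiet_big A' m' (subset_trans s (sA m))).
  lia.
(* Since [value B - |value B - d| <= d], it is enough that the quiet move gives away at least [d]
   boxes. *)
- have := take_all B (takeableS (sA m) tA).
  have := card_unclaimed A m; have := quiet_big A m (subxx _) mX cm; lia.
- by rewrite qB in cm.
- have := take_all (B :\ m) tA; have := value_le_quiet mX cm; lia.
Qed.

(* Positions from which the player to move can give away the last [d] boxes
   and hand over the turn. *)
Inductive dealable (d : nat) : {set line C} -> Prop :=
| Deal A m : m \in A -> captures A m = 0 -> loose (A :\ m) ->
    #|unclaimed A| = d -> dealable d A
| Take A m : m \in A -> 0 < captures A m -> dealable d (A :\ m) -> dealable d A.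

(** With [n] boxes in [A], the player to move captures [n - d] of them, gives up [d] and makes the
    opponent start on [B]: the opponent nets [d - (n - d) - value B]. *)
Lemma dealable_le d A B : dealable d A ->
  (value (join A B) <= d%:Z *+ 2 - #|unclaimed A|%:Z - value B)%R.
Proof.
elim=> {A} [A m mA cm lA dA|A m mA cm _ IH].
  have := value_join_quiet B mA cm; have := loose_ge B lA.
  have := card_unclaimed A m; lia.
have := value_join_capture B mA cm; have := card_unclaimed A m; lia.
Qed.

(** With [n] boxes in [C], taking everything gives [v D - n] and dealing gives [2d - n - v D]. The
    smaller of these, [d - n - |v D - d|], is also the lower bound of [opened_ge]; the opening is
    quiet, so its value is the negation. *)
Lemma v_open d (e : line C) :
  (forall m, captures [set: line C] m = 0) -> (forall m, captures [set: line D] m = 0) ->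
  takeable (setT :\ e) -> dealable d (setT :\ e) ->
  (forall A' m, A' \subset setT :\ e -> m \in A' -> captures A' m = 0 ->
     d <= #|unclaimed A'|) ->
  (@v_move (union C D) (inl e) =
   #|unclaimed [set: line C]|%:Z - d%:Z + `|v D - d%:Z|)%R.
Proof.
move=> qC qD tA dA big; rewrite /v_move move_valueE joinTT captures_join_inl joinD1l qC /=.
have := opened_ge tA big qD; have := take_all setT tA; have := dealable_le setT dA.
rewrite -/(v D); have := card_unclaimed setT e; rewrite qC; lia.
Qed.

End UnionPositions.

(** * Opening a loop or a 3-chain *)

Section LoopOpening.
Variable n : nat.
Hypothesis n_ge4 : 4 <= n.
Implicit Types (x y e : 'I_n).

Lemma val_iter_ordS k e : (iter k (@ordS n) e : nat) = (e + k) %% n.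
Proof.
elim: k => [|k IHk]; first by rewrite addn0 modn_small.
by rewrite iterS /= IHk -addn1 modnDml addn1 addnS.
Qed.

Lemma iter_ordS_inj e i j : i < n -> j < n ->
  iter i (@ordS n) e = iter j (@ordS n) e -> i = j.
Proof.
move=> ltin ltjn /(congr1 val) /=; rewrite !val_iter_ordS => /eqP.
by rewrite eqn_modDl !modn_small // => /eqP.
Qed.

Lemma iter_ordS_surj e x : exists2 k, k < n & x = iter k (@ordS n) e.
Proof.
have n_gt0 : 0 < n by apply: leq_trans n_ge4.
exists ((x + (n - e)) %% n); first by rewrite ltn_mod.
apply: val_inj; rewrite /= val_iter_ordS modnDmr addnCA subnKC; last exact: ltnW.
by rewrite modnDr modn_small.
Qed.

Lemma mem_loop_border b (m : line (loop n)) :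
  (b \in border m) = (b == m) || (b == ordS m).
Proof. by rewrite !inE. Qed.

Lemma ordS_neq x : ordS x != x.
Proof.
apply/eqP => E; have := @iter_ordS_inj x 1 0 _ _ E.
by rewrite !(leq_trans _ n_ge4) // => /(_ isT isT).
Qed.

Lemma loop_quiet (m : line (loop n)) : captures setT m = 0.
Proof.
apply: captures0 => b; rewrite mem_loop_border => /orP[]/eqP->.
  apply/unclaimedP; exists (ord_pred m); last by rewrite mem_loop_border ord_predK eqxx orbT.
  rewrite !inE andbT -[X in _ == X]ord_predK eq_sym; exact: ordS_neq.
apply/unclaimedP; exists (ordS m); last by rewrite mem_loop_border eqxx.
by rewrite !inE andbT ordS_neq.
Qed.

Lemma card_loop : #|unclaimed [set: line (loop n)]| = n.
Proof.
rewrite -[RHS]card_ord -cardsT; congr #|pred_of_set _|; apply/setP => b.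
rewrite [RHS]inE; apply/unclaimedP; exists b => //.
by rewrite mem_loop_border eqxx.
Qed.

Lemma loop_capture (S : {set line (loop n)}) x : x \in S -> ordS x \notin S ->
  0 < captures S x.
Proof.
move=> xS oxS; apply: (@captures_gt0 (loop n) _ _ (ordS x)) => //.
  by rewrite mem_loop_border eqxx orbT.
move=> y yS; rewrite mem_loop_border => /orP[/eqP E|/eqP/(can_inj (@ordSK n))//].
by rewrite E yS in oxS.
Qed.

Lemma loop_takeable (e : line (loop n)) : takeable (setT :\ e).
Proof.
move=> A sA /set0Pn[x xA].
have [/existsP[y /andP[yA oy]]|closed] := boolP [exists y in A, ordS y \notin A].
  by exists y => //; apply: loop_capture.
(* If no line of [A] has its successor outside [A], then [A] is closed under [ordS] and so contains
   the drawn line [e]. *)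
have step y : y \in A -> ordS y \in A.
  move=> yA; apply: contraNT closed => oy; apply/existsP; exists y; exact/andP.
have [k _ E] := iter_ordS_surj x e.
suff /(subsetP sA) : e \in A by rewrite !inE eqxx.
by rewrite E; elim: k {E} => //= k; apply: step.
Qed.

Lemma card_iter_ordS x : #|[set iter k (@ordS n) x | k : 'I_4]| = 4.
Proof.
rewrite card_imset ?card_ord // => i j /iter_ordS_inj E.
by apply/val_inj/E; apply: leq_trans n_ge4.
Qed.

(** If [x] captures nothing, the lines just before and after it are undrawn too, and three
    consecutive lines border four distinct boxes. *)
Lemma loop_quiet_big (A : {set line (loop n)}) x : x \in A -> captures A x = 0 ->
  4 <= #|unclaimed A|.
Proof.
move=> xA cx.
have [|y /setD1P[yx yA]] := @captures0_other (loop n) _ _ x cx xA.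
  by rewrite mem_loop_border eqxx.
rewrite mem_loop_border eq_sym (negPf yx) /= => /eqP Ey.
have [|z /setD1P[zx zA]] := @captures0_other (loop n) _ _ (ordS x) cx xA.
  by rewrite mem_loop_border eqxx orbT.
rewrite mem_loop_border => /orP[/eqP Ez|/eqP/(can_inj (@ordSK n))xz]; last first.
  by rewrite xz eqxx in zx.
rewrite -(card_iter_ordS y); apply/subset_leq_card/subsetP => _ /imsetP[k _ ->].
apply/(@unclaimedP (loop n)); case: k => -[|[|[|[|//]]]] /= _.
- by exists y => //; rewrite mem_loop_border eqxx.
- by exists y => //; rewrite mem_loop_border eqxx orbT.
- by exists x => //; rewrite mem_loop_border -Ey eqxx orbT.
- by exists z => //; rewrite mem_loop_border -Ey Ez eqxx orbT.
Qed.

(** The number of [ordS] steps from [e] to [x]. Thus [arc e j] is the loop opened at [e] and then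
    captured from its far end until [j] lines remain. *)
Let rank e x := (x + (n - e)) %% n.
Let arc e j : {set line (loop n)} := [set x | 0 < rank e x <= j].

Lemma mem_arc e j k : k < n -> (iter k (@ordS n) e \in arc e j) = (0 < k <= j).
Proof.
move=> ltkn; rewrite inE /rank val_iter_ordS modnDml -addnA addnCA subnKC.
  by rewrite addnC addnC modnDr modn_small.
exact: ltnW.
Qed.

Lemma iter_ordS_n e : iter n (@ordS n) e = e.
Proof. by apply: val_inj; rewrite /= val_iter_ordS modnDr modn_small. Qed.

Lemma arcD1 e j : j.+1 < n -> arc e j.+1 :\ iter j.+1 (@ordS n) e = arc e j.
Proof.
move=> ltjn; apply/setP => x; rewrite in_setD1.
have [k ltkn ->] := iter_ordS_surj e x; rewrite !mem_arc //.
case: (eqVneq k j.+1) => [->|kj]; first by rewrite eqxx ltnn andbF.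
suff -> : iter k (@ordS n) e != iter j.+1 (@ordS n) e by lia.
by apply: contraNneq kj => /iter_ordS_inj ->.
Qed.

Lemma arc_full e : arc e n.-1 = setT :\ e.
Proof.
apply/setP => x; rewrite in_setD1 in_setT andbT.
have [k ltkn ->] := iter_ordS_surj e x; rewrite mem_arc //.
case: k ltkn => [|k] ltkn; first by rewrite eqxx.
have -> : k.+1 <= n.-1 by lia.
apply/esym/eqP => E; by have := @iter_ordS_inj e k.+1 0 ltkn (leq_ltn_trans (leq0n _) ltkn) E.
Qed.

(** Lines are captured from the far end until three are left, bordering four boxes. Drawing the
    middle one captures nothing and leaves two lines with two boxes each. *)
Lemma arc_dealable e j : 3 <= j < n -> dealable 4 (arc e j).
Proof.
pose r k : line (loop n) := iter k (@ordS n) e.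
have n_gt k : k < 4 -> k < n by move=> lt; apply: leq_trans lt n_ge4.
elim: j => // j IHj /andP[]; rewrite leq_eqVlt => /orP[/eqP[<-] _|gt3 ltjn].
  have sub k : k < n -> (r k \in arc e 3 :\ r 2) = (k == 1) || (k == 3).
    move=> ltkn; rewrite in_setD1 mem_arc //.
    case: (eqVneq k 2) => [->|k2]; first by rewrite eqxx.
    suff -> : r k != r 2 by lia.
    by apply: contraNneq k2 => /iter_ordS_inj -> //; apply: n_gt.
  have r1 : r 1 \in arc e 3 :\ r 2 by rewrite sub ?n_gt.
  have r3 : r 3 \in arc e 3 :\ r 2 by rewrite sub ?n_gt.
  apply: (@Deal _ _ _ (r 2)).
  - by rewrite mem_arc ?n_gt.
  - apply: captures0 => b; rewrite mem_loop_border => /orP[]/eqP->.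
      by apply/unclaimedP; exists (r 1); rewrite // mem_loop_border eqxx orbT.
    by apply/unclaimedP; exists (r 3); rewrite // mem_loop_border eqxx.
  - move=> x b y xS bx yS by_.
    have two z : z \in arc e 3 :\ r 2 -> z = r 1 \/ z = r 3.
      have [k ltkn ->] := iter_ordS_surj e z; rewrite sub // => /orP[]/eqP->; tauto.
    have r4 : ordS (r 3) \notin arc e 3 :\ r 2.
      (* For [n = 4] the walk closes up and [r 4] is the drawn line [e]; for larger [n] it lies
         beyond the arc. *)
      rewrite -[ordS _]/(r 4); have := n_ge4; rewrite leq_eqVlt => /orP[/eqP E|lt].
        have -> : r 4 = r 0 by rewrite /r {1}E iter_ordS_n.
        by rewrite sub // n_gt.
      by rewrite sub.
    have r2 : ordS (r 1) \notin arc e 3 :\ r 2 by rewrite -[ordS _]/(r 2) sub ?n_gt.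
    move: bx by_; rewrite !mem_loop_border.
    have no u w : u \in arc e 3 :\ r 2 -> w \in arc e 3 :\ r 2 -> u <> ordS w.
      by move=> uS /two[]-> E; rewrite -E uS in r2 r4.
    move=> /orP[]/eqP-> /orP[]/eqP E.
    + by [].
    + by case: (no x y).
    + by case: (no y x).
    + exact/esym/(can_inj (@ordSK n)).
  - rewrite -(card_iter_ordS (r 1)); congr #|pred_of_set _|; apply/setP => b.
    apply/unclaimedP/imsetP => [[m]|[k _ ->]].
      have [k ltkn ->] := iter_ordS_surj e m; rewrite mem_arc // => /andP[k0 k3].
      have ltk : k.-1 < 4 by lia.
      have lt2k : k < 4 by lia.
      rewrite mem_loop_border => /orP[]/eqP->; last first.
        by exists (Ordinal lt2k); rewrite //= -iterSr.
      by exists (Ordinal ltk); rewrite //= -iterSr prednK.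
    rewrite /r -iterSr; case: k => -[|[|[|[|//]]]] /= _.
    + by exists (r 1); rewrite ?mem_arc ?n_gt // mem_loop_border eqxx.
    + by exists (r 1); rewrite ?mem_arc ?n_gt // mem_loop_border eqxx orbT.
    + by exists (r 2); rewrite ?mem_arc ?n_gt // mem_loop_border eqxx orbT.
    + by exists (r 3); rewrite ?mem_arc ?n_gt // mem_loop_border eqxx orbT.
apply: (@Take _ _ _ (r j.+1)); last by rewrite arcD1 //; apply: IHj; lia.
  by rewrite mem_arc // leqnn.
apply: loop_capture; first by rewrite mem_arc // leqnn.
rewrite -[ordS _]/(r j.+2); move: ltjn; rewrite leq_eqVlt => /orP[/eqP E|lt].
  have -> : r j.+2 = r 0 by rewrite /r {1}E iter_ordS_n.
  by rewrite mem_arc // n_gt.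
by rewrite mem_arc // ltnn.
Qed.

Lemma loop_open (D : game) (e : line (loop n)) :
  (forall m, captures [set: line D] m = 0) ->
  (@v_move (union (loop n) D) (inl e) = (n - 4)%:Z + `|v D - 4%:Z|)%R.
Proof.
move=> qD; rewrite (@v_open _ _ 4) //.
- by rewrite card_loop; lia.
- exact: loop_quiet.
- exact: loop_takeable.
- by rewrite -arc_full; apply: arc_dealable; lia.
- by move=> A m _; apply: loop_quiet_big.
Qed.

End LoopOpening.

Section ChainOpening.
Implicit Types A : {set line chain3}.

Let c (k : nat) : line chain3 := @inord 3 k.

Lemma mem_unclaimed_chain3 A (b : 'I_3) :
  (b \in unclaimed A) = (c b \in A) || (c b.+1 \in A).
Proof.
apply/unclaimedP/orP => [[m mA]|[] h].
- rewrite inE => /orP[]/eqP E; [left|right]; rewrite /c -E inord_val //.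
- exists (c b) => //; rewrite inE /c inordK ?eqxx //; exact: (ltn_trans (ltn_ord b)).
- exists (c b.+1) => //; rewrite inE /c inordK ?eqxx ?orbT //; exact: (ltn_ord b).
Qed.

(** Reduces questions about captures in the 3-chain to boolean checks on which of its four lines
    remain. *)
Lemma card_unclaimed_chain3 A : #|unclaimed A| =
  ((c 0 \in A) || (c 1 \in A)) + ((c 1 \in A) || (c 2 \in A))
  + ((c 2 \in A) || (c 3 \in A)).
Proof.
rewrite -sum1_card big_mkcond /= !big_ord_recl big_ord0 !mem_unclaimed_chain3 /=.
by do 3! case: (_ || _).
Qed.

Lemma chain3_ind (P : line chain3 -> Prop) :
  P (c 0) -> P (c 1) -> P (c 2) -> P (c 3) -> forall m, P m.
Proof.
by move=> P0 P1 P2 P3 m; rewrite -(inord_val m); case: m => -[|[|[|[|]]]].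
Qed.

Lemma mem_chain3D1 A i j : i < 4 -> j < 4 ->
  (c i \in A :\ c j) = (i != j) && (c i \in A).
Proof. by move=> lti ltj; rewrite in_setD1 -val_eqE /= !inordK. Qed.

Lemma captures_chain3 A m : captures A m = #|unclaimed A| - #|unclaimed (A :\ m)|.
Proof. by rewrite (card_unclaimed A m) addnK. Qed.

Let chain3E := (captures_chain3, card_unclaimed_chain3, mem_chain3D1).

Lemma chain3_quiet (m : line chain3) : captures setT m = 0.
Proof. by elim/chain3_ind: m; rewrite !chain3E // !inE. Qed.

Lemma chain3_takeable (e : line chain3) : takeable (setT :\ e).
Proof.
move=> A /subsetP sA A0.
have eA : e \in A = false by apply/negbTE/negP => /sA; rewrite !inE eqxx.
have [m /andP[mA cm]|none] := pickP [pred m | (m \in A) && (0 < captures A m)].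
  by exists m.
case/set0Pn: A0 => x; move: (none (c 0)) (none (c 1)) (none (c 2)) (none (c 3)).
rewrite /= !chain3E //=; elim/chain3_ind: e eA {sA none}; elim/chain3_ind: x;
  by case: (c 0 \in A); case: (c 1 \in A); case: (c 2 \in A); case: (c 3 \in A).
Qed.

Lemma chain3_quiet_big A m : m \in A -> captures A m = 0 -> 2 <= #|unclaimed A|.
Proof.
elim/chain3_ind: m; rewrite !chain3E //=;
  by case: (c 0 \in A); case: (c 1 \in A); case: (c 2 \in A); case: (c 3 \in A).
Qed.

Lemma chain3_dealable (e : line chain3) : dealable 2 (setT :\ e).
Proof.
(* Here [i] is the opened line, [j] captures one box, [k] is the quiet move, and [l] is left to the
   opponent with the last two boxes. *)
have deal i j k l : i < 4 -> j < 4 -> k < 4 -> l < 4 -> uniq [:: i; j; k; l] ->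
    0 < captures (setT :\ c i) (c j) ->
    captures (setT :\ c i :\ c j) (c k) = 0 ->
    #|unclaimed (setT :\ c i :\ c j)| = 2 -> dealable 2 (setT :\ c i).
  move=> lti ltj ltk ltl uniq_s cj ck u2.
  apply: (@Take _ _ _ (c j)) => //; first by rewrite !mem_chain3D1 // in_setT; move: uniq_s; rewrite /= !inE; lia.
  apply: (@Deal _ _ _ (c k)) => //; first by rewrite !mem_chain3D1 // in_setT; move: uniq_s; rewrite /= !inE; lia.
  have only m : m \in setT :\ c i :\ c j :\ c k -> m = c l.
    move=> mS; apply/eqP; rewrite -val_eqE /= inordK //.
    move: mS uniq_s; rewrite -(inord_val m) !mem_chain3D1 // inordK // /= !inE.
    by have := ltn_ord m; lia.
  by move=> m b m' /only-> _ /only->.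
by elim/chain3_ind: e; [apply: (deal 0 1 3 2) | apply: (deal 1 0 3 2)
  | apply: (deal 2 3 0 1) | apply: (deal 3 2 0 1)];
  rewrite // !chain3E // !inE.
Qed.

Lemma chain3_open (D : game) (e : line chain3) :
  (forall m, captures [set: line D] m = 0) ->
  (@v_move (union chain3 D) (inl e) = 1 + `|v D - 2%:Z|)%R.
Proof.
move=> qD; rewrite (@v_open _ _ 2) //.
- by rewrite card_unclaimed_chain3 !inE.
- exact: chain3_quiet.
- exact: chain3_takeable.
- exact: chain3_dealable.
- by move=> A m _; apply: chain3_quiet_big.
Qed.

End ChainOpening.

(** * Isomorphic games *)

Definition game_iso (G H : game) (f : line G -> line H) : Prop :=
  bijective f /\ exists2 g : box G -> box H, bijective g &
    forall m, border (f m) = g @: border m.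

Lemma bij_imsetT (S T : finType) (f : S -> T) : bijective f -> f @: setT = setT.
Proof.
case=> f' fK f'K; apply/setP => x; rewrite in_setT.
by apply/imsetP; exists (f' x); rewrite ?f'K.
Qed.

Lemma v_move_iso (G H : game) (f : line G -> line H) m :
  game_iso f -> v_move (f m) = v_move m.
Proof.
case=> bij_f [g bij_g fg]; rewrite /v_move -(bij_imsetT bij_f).
exact: move_value_embed (bij_inj bij_f) (bij_inj bij_g) fg _ _.
Qed.

Lemma v_iso (G H : game) (f : line G -> line H) : game_iso f -> v H = v G.
Proof.
case=> bij_f [g bij_g fg]; rewrite /v -(bij_imsetT bij_f).
exact: value_embed (bij_inj bij_f) (bij_inj bij_g) fg _.
Qed.

Lemma game_iso_id (G : game) : game_iso (@id (line G)).
Proof.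
split; first by exists id.
by exists id => [|m]; [exists id | rewrite imset_id].
Qed.

Lemma game_iso_comp (G H K : game) (f : line G -> line H) (f' : line H -> line K) :
  game_iso f -> game_iso f' -> game_iso (f' \o f).
Proof.
case=> bij_f [g bij_g fg] [bij_f' [g' bij_g' fg']]; split; first exact: bij_comp.
by exists (g' \o g) => [|m]; [exact: bij_comp | rewrite fg' fg imset_comp].
Qed.

Definition map_inr (A B C : Type) (f : B -> C) (x : A + B) : A + C :=
  match x with inl a => inl a | inr b => inr (f b) end.

Definition sum_swap (A B : Type) (x : A + B) : B + A :=
  match x with inl a => inr a | inr b => inl b end.

Definition sum_exchange (A B C : Type) (x : A + (B + C)) : B + (A + C) :=
  match x with inl a => inr (inl a) | inr (inl b) => inl b
             | inr (inr c) => inr (inr c) end.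

Lemma map_inr_bij (A B C : Type) (f : B -> C) : bijective f -> bijective (@map_inr A B C f).
Proof.
by case=> f' fK f'K; exists (map_inr f') => -[a|b] //=; rewrite ?fK ?f'K.
Qed.

Lemma sum_swap_bij (A B : Type) : bijective (@sum_swap A B).
Proof. by exists (@sum_swap B A) => -[]. Qed.

Lemma sum_exchange_bij (A B C : Type) : bijective (@sum_exchange A B C).
Proof. by exists (@sum_exchange B A C) => -[|[]]. Qed.

Lemma game_iso_union (C G H : game) (f : line G -> line H) :
  game_iso f -> @game_iso (union C G) (union C H) (map_inr f).
Proof.
case=> bij_f [g bij_g fg]; split; first exact: map_inr_bij.
exists (map_inr g); first exact: map_inr_bij.
by case=> m /=; rewrite ?fg -!imset_comp.
Qed.

Lemma game_iso_swap (G H : game) : @game_iso (union G H) (union H G) (@sum_swap _ _).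
Proof.
split; first exact: sum_swap_bij.
exists (@sum_swap _ _); first exact: sum_swap_bij.
by case=> m /=; rewrite -imset_comp.
Qed.

Lemma game_iso_exchange (C G H : game) :
  @game_iso (union C (union G H)) (union G (union C H)) (@sum_exchange _ _ _).
Proof.
split; first exact: sum_exchange_bij.
exists (@sum_exchange _ _ _); first exact: sum_exchange_bij.
by case=> [|[]] m /=; rewrite -!imset_comp.
Qed.

Lemma perm_cons2 (T : eqType) (a b : T) s : perm_eq (a :: b :: s) (b :: a :: s).
Proof. by rewrite -[a :: b :: s]/([:: a] ++ [:: b] ++ s) perm_catCA. Qed.

(** * Values of simple loony endgames *)

Section LoonyEndgames.

Definition component (c : option nat) : game :=
  if c is Some n then loop n else chain3.

Definition components (s : seq (option nat)) : game :=
  foldr (fun c => union (component c)) empty_game s.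

Definition admissible (c : option nat) : bool :=
  if c is Some n then loop_length n else true.

(** The formula [n - d + |x - d|] for opening a component of [n] boxes when the rest has value [x];
    the chain has [n = 3] and [d = 2]. *)
Definition open_value (c : option nat) (x : int) : int :=
  (if c is Some n then (n - 4)%:Z + `|x - 4| else 1 + `|x - 2|)%R.

Notation V s := (v (components s)).

Implicit Types (s t : seq (option nat)) (c : option nat).

Lemma loopsE ks : loops ks = components (map Some ks).
Proof. by elim: ks => //= k ks ->. Qed.

Lemma components_quiet s : all admissible s ->
  forall m : line (components s), captures setT m = 0.
Proof.
elim: s => [_ []|c s IHs /andP[ac /IHs qs]] m.
rewrite /= joinTT; case: m => m; last by rewrite captures_join_inr qs.
rewrite captures_join_inl; case: c ac m => [n|] ac m; last exact: chain3_quiet.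
by apply: loop_quiet; case/andP: ac.
Qed.

Lemma v_move_component c t (e : line (component c)) :
  admissible c -> all admissible t ->
  @v_move (union (component c) (components t)) (inl e) = open_value c (V t).
Proof.
case: c e => [n|] e ac at_; last exact: chain3_open (components_quiet at_).
by apply: loop_open (components_quiet at_); case/andP: ac.
Qed.

Lemma components_cat t1 c t2 : exists f : line (components (t1 ++ c :: t2)) ->
  line (union (component c) (components (t1 ++ t2))), game_iso f.
Proof.
elim: t1 => [|c1 t1 [f iso_f]]; first by exists id; apply: game_iso_id.
exists (@sum_exchange _ _ _ \o map_inr f).
exact: game_iso_comp (game_iso_union _ iso_f) (game_iso_exchange _ _ _).
Qed.

Lemma components_perm s t : perm_eq s t ->
  exists f : line (components t) -> line (components s), game_iso f.
Proof.
elim: s t => [|c s IHs] t pst.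
  have /nilP -> : nilp t by rewrite /nilp -(perm_size pst).
  by exists id; apply: game_iso_id.
have c_t : c \in t by rewrite -(perm_mem pst) mem_head.
case/splitPr: c_t pst => t1 t2.
rewrite perm_sym perm_catC /= perm_cons perm_catC perm_sym => /IHs[f iso_f].
have [f' iso_f'] := components_cat t1 c t2; exists (map_inr f \o f').
exact: game_iso_comp iso_f' (game_iso_union _ iso_f).
Qed.

Lemma V_perm s t : perm_eq s t -> V s = V t.
Proof. by case/components_perm => f /v_iso. Qed.

(** Moves any line into the first summand, where [v_move_component] evaluates it. *)
Lemma components_locate s (e : line (components s)) :
  exists c t (e' : line (component c))
    (f : line (components s) -> line (union (component c) (components t))),
  [/\ perm_eq s (c :: t), game_iso f & f e = inl e'].
Proof.
elim: s e => [[]|c s IHs] [e|e].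
  by exists c, s, e, id; split=> //; apply: game_iso_id.
have [c1 [t [e' [f [pst iso_f fe]]]]] := IHs e.
exists c1, (c :: t), e', (@sum_exchange _ _ _ \o map_inr f); split.
- by apply: perm_trans (perm_cons2 _ _ _); rewrite perm_cons.
- exact: game_iso_comp (game_iso_union _ iso_f) (game_iso_exchange _ _ _).
- by rewrite /= fe.
Qed.

Lemma component_line c : admissible c -> line (component c).
Proof.
case: c => [n|_]; last exact: (ord0 : 'I_4).
by case/andP=> n_ge4 _; apply: (Ordinal (leq_trans _ n_ge4 : 0 < n)).
Qed.

Lemma V_le_open c t : admissible c -> all admissible t ->
  (V (c :: t) <= open_value c (V t))%R.
Proof.
move=> ac at_; have e := component_line ac.
rewrite -(v_move_component e ac at_).
have h : (inl e : line (components (c :: t))) \in [set: _] by rewrite in_setT.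
by apply: (value_min _).2 h; apply/set0Pn; exists (inl e).
Qed.

Lemma V_nil : V [::] = 0%R.
Proof.
rewrite /v (_ : [set: _] = set0) ?value0 //.
by apply/setP => -[].
Qed.

(** Together with [V_le_open] this makes [V s] the minimum of [open_value c (V t)] over the ways to
    split off a component [c] from [s]. *)
Lemma V_option s : s != [::] -> all admissible s ->
  exists c t, [/\ perm_eq s (c :: t), admissible c, all admissible t
    & V s = open_value c (V t)].
Proof.
move=> s0 as_; have : [set: line (components s)] != set0.
  case: s s0 as_ => // c s _ /andP[ac _]; apply/set0Pn.
  by exists (inl (component_line ac)).
case/value_min => -[e _ Ve] _; have [c [t [e' [f [pst iso_f fe]]]]] := components_locate e.
have /andP[ac at_] : all admissible (c :: t) by rewrite -(perm_all _ pst).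
exists c, t; split=> //.
by rewrite [LHS]Ve -/(v_move e) -(v_move_iso _ iso_f) fe v_move_component.
Qed.

Lemma V_ge0 s : all admissible s -> (0 <= V s)%R.
Proof.
have [->|s0 as_] := eqVneq s [::]; first by rewrite V_nil.
by have [[n|] [t [_ _ _ ->]]] := V_option s0 as_; rewrite /open_value; lia.
Qed.

(** Opening a loop of even length keeps the parity of the value of the rest, and opening a 3-chain
    flips it. *)
Lemma V_parity s : all admissible s ->
  exists k : int, V s = (k * 2 + (count_mem None s)%:Z)%R.
Proof.
have [n le_n] := ubnP (size s); elim: n => // n IHn in s le_n *.
have [-> _|s0 as_] := eqVneq s [::]; first by exists 0%R; rewrite V_nil.
have [c [t [pst ac at_ ->]]] := V_option s0 as_.
have [|k ->] := IHn t _ at_; first by rewrite (perm_size pst) in le_n.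
move/permP: pst => ->; case: c ac => [l|_] /=.
  case/andP => l4 /negPf l_even; have := odd_double_half l; rewrite l_even -muln2.
  set h := l./2; set m := count_mem _ t => def_l.
  case: (lerP 4 (k * 2 + m%:Z)%R) => le4.
    by exists (h%:Z - 4 + k)%R; lia.
  (* Here the absolute value reverses the sign, and [- m] is written as [m - 2m]. *)
  by exists (h%:Z - k - m%:Z)%R; lia.
set m := count_mem _ t.
case: (lerP 2 (k * 2 + m%:Z)%R) => le2.
  by exists (k - 1)%R; lia.
by exists (1 - k - m%:Z)%R; lia.
Qed.

(** * Comparison of loops of different lengths *)

Lemma open_value_lipschitz c (x y d : int) : (`|x - y| <= d)%R ->
  (open_value c x <= open_value c y + d)%R.
Proof. by case: c => [n|]; rewrite /open_value; lia. Qed.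

(** Induction on the other components. If one of these is opened, the same opening in the other
    endgame reduces to a smaller [t], as [open_value c] does not enlarge differences. *)
Lemma V_loop_lipschitz a b t : loop_length a -> loop_length b -> all admissible t ->
  a <= b -> (`|V (Some a :: t) - V (Some b :: t)| <= b%:Z - a%:Z)%R.
Proof.
move=> la lb at_ leab.
have [n le_n] := ubnP (size t); elim: n => // n IHn in t le_n at_ *.
have a4 : 4 <= a by case/andP: la.
(* The best opening for [y] is copied for [x]. *)
have half x y : loop_length x -> loop_length y ->
    (forall c t', perm_eq t (c :: t') ->
       `|V (Some x :: t') - V (Some y :: t')| <= b%:Z - a%:Z)%R ->
    (x%:Z - y%:Z <= b%:Z - a%:Z)%R ->
    (V (Some x :: t) <= V (Some y :: t) + (b%:Z - a%:Z))%R.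
  move=> lx ly IH lexy.
  have ay : all admissible (Some y :: t) by rewrite /= ly.
  have [c [u [ptu ac au ->]]] := @V_option (Some y :: t) isT ay.
  have [x4 y4] : 4 <= x /\ 4 <= y by split; [case/andP: lx | case/andP: ly].
  have [Ec|cy] := eqVneq c (Some y).
    (* Opening the distinguished loop leaves [t] on both sides, so the values of the two openings
       differ by [x - y]. *)
    rewrite Ec perm_cons in ptu; rewrite -(V_perm ptu) Ec /=.
    apply: le_trans (@V_le_open (Some x) t lx at_) _; rewrite /=.
    by move: lexy x4 y4; move: (V t) => w; lia.
  have c_t : c \in t.
    by have := perm_mem ptu c; rewrite mem_head in_cons (negPf cy).
  have pt := perm_to_rem c_t; have au' : all admissible (rem c t).
    by have := at_; rewrite (perm_all _ pt) => /andP[].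
  have pu : perm_eq u (Some y :: rem c t).
    rewrite -(perm_cons c) perm_sym; apply: perm_trans ptu.
    by apply: perm_trans (perm_cons2 _ _ _) _; rewrite perm_cons perm_sym.
  have px : perm_eq (Some x :: t) (c :: Some x :: rem c t).
    by apply: perm_trans (perm_cons2 _ _ _); rewrite perm_cons.
  rewrite (V_perm px) (V_perm pu).
  apply: le_trans (open_value_lipschitz _ (IH _ _ pt)).
  by apply: V_le_open; rewrite //= lx.
have IH c t' : perm_eq t (c :: t') ->
    (`|V (Some a :: t') - V (Some b :: t')| <= b%:Z - a%:Z)%R.
  move=> pt; apply: IHn; first by rewrite (perm_size pt) in le_n.
  by move: at_; rewrite (perm_all _ pt) => /andP[].
have h1 : (V (Some a :: t) <= V (Some b :: t) + (b%:Z - a%:Z))%R.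
  by apply: half => //; lia.
have h2 : (V (Some b :: t) <= V (Some a :: t) + (b%:Z - a%:Z))%R.
  by apply: half => // c t' /IH; rewrite distrC.
by move: h1 h2; move: (V _) (V _) => u w; lia.
Qed.

(** Opening [l] instead of [z] saves [z - l] at once, and the values of what is left differ by at
    most [z - l]. *)
Lemma smallest_loop_best l z t : loop_length l -> loop_length z ->
  all admissible t -> l <= z ->
  (open_value (Some l) (V (Some z :: t)) <= open_value (Some z) (V (Some l :: t)))%R.
Proof.
move=> ll lz at_ lelz; have := V_loop_lipschitz ll lz at_ lelz.
have l4 : 4 <= l by case/andP: ll.
rewrite /open_value; move: (V _) (V _) => u w; lia.
Qed.

(** Cuts the minimum down to two candidates: an optimal opening of a loop [z] can be exchanged for
    one of [l]. *)
Lemma V_smallest_loop_or_chain l s : loop_length l -> all admissible s ->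
  (forall z, Some z \in s -> l <= z) ->
  V (Some l :: s) = open_value (Some l) (V s) \/
  exists2 t, perm_eq s (None :: t) &
    V (Some l :: s) = open_value None (V (Some l :: t)).
Proof.
move=> ll as_ min_l.
have als : all admissible (Some l :: s) by rewrite /= ll.
have [c [t [pt ac at_ Vt]]] := @V_option (Some l :: s) isT als.
have [El|cl] := eqVneq c (Some l).
  by left; rewrite Vt El (@V_perm s t) // -(perm_cons (Some l)) -{2}El.
have := perm_mem pt c; rewrite mem_head in_cons (negPf cl) orFb => /esym c_s.
have [u ps] : exists u, perm_eq s (c :: u) by exists (rem c s); apply: perm_to_rem.
have pt' : perm_eq t (Some l :: u).
  rewrite -(perm_cons c) perm_sym; apply: perm_trans pt.
  by apply: perm_trans (perm_cons2 _ _ _) _; rewrite perm_cons perm_sym.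
rewrite (V_perm pt') in Vt; case: c {cl pt} => [z|] in ac Vt c_s ps pt' *.
  left; apply/eqP; rewrite eq_le; apply/andP; split; first exact: V_le_open.
  rewrite Vt (V_perm ps).
  apply: smallest_loop_best => //; last exact: min_l.
  by have := as_; rewrite (perm_all _ ps) => /andP[].
by right; exists u.
Qed.

Definition is_loop_ge (m : nat) c : bool := if c is Some n then m <= n else false.

Lemma V_loops_ge m s : s != [::] -> all admissible s -> all (is_loop_ge m) s ->
  (m%:Z - 4 <= V s)%R.
Proof.
move=> s0 as_ ge_m; have [c [t [pt _ _ ->]]] := V_option s0 as_.
have := perm_all (is_loop_ge m) pt; rewrite ge_m; case: c {pt} => [k|//] /esym/andP[/= mk _].
by move: (V t) => x; lia.
Qed.

(* A value 4 requires opening an 8-loop and leaving a smaller sum of value 4. *)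
Lemma V_large_loops s : all admissible s -> all (is_loop_ge 8) s -> V s <> 4%R.
Proof.
have [n le_n] := ubnP (size s); elim: n => // n IHn in s le_n *.
have [-> _ _|s0 as_ ge8] := eqVneq s [::]; first by rewrite V_nil.
have [c [t [pt _ at_ ->]]] := V_option s0 as_.
have := perm_all (is_loop_ge 8) pt; rewrite ge8 => /esym/andP[].
case: c pt => [k|//] pt /= k8 ge8t.
have := IHn t _ at_ ge8t; rewrite (perm_size pt) in le_n; move/(_ le_n).
by move: (V t) => x; lia.
Qed.

Lemma opening_dichotomy ks l : all loop_length (l :: ks) -> all (leq l) ks ->
  let s := map Some ks in
  let x := V (Some l :: s) in
  let o3 := open_value None x in
  let ol := open_value (Some l) (V (None :: s)) in
  let w := V (None :: Some l :: s) in
  [/\ x = 2%R -> w = o3,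
      x <> 2%R -> l = 6 /\ V s = 2%R -> w = o3
    & x <> 2%R -> ~ (l = 6 /\ V s = 2%R) -> w = ol].
Proof.
move=> /= /andP[ll lks] min_l.
set s := map Some ks.
have as_ : all admissible s by rewrite all_map.
have ge_l z : Some z \in s -> l <= z.
  by rewrite mem_map; [exact: (allP min_l) | move=> ? ? []].
have None_s : None \notin s by apply/mapP => -[].
have aH : all admissible (Some l :: s) by rewrite /= ll.
have Vx : V (Some l :: s) = open_value (Some l) (V s).
  (* There is no chain in [s], so only the loop can be opened. *)
  have [//|[t /perm_mem/(_ None)]] := V_smallest_loop_or_chain ll as_ ge_l.
  by rewrite mem_head (negPf None_s).
have psw : perm_eq (None :: Some l :: s) (Some l :: None :: s).
  exact: perm_cons2.
have w_cases : V (None :: Some l :: s) = open_value (Some l) (V (None :: s)) \/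
    V (None :: Some l :: s) = open_value None (V (Some l :: s)).
  rewrite !(V_perm psw).
  have [||E|[t pt ->]] := @V_smallest_loop_or_chain l (None :: s) ll.
  - by [].
  - by move=> z; rewrite in_cons => /orP[//|]; apply: ge_l.
  - by left.
  - by right; rewrite (@V_perm (Some l :: t) (Some l :: s)) // !perm_cons perm_sym -(perm_cons None).
have w_le3 : (V (None :: Some l :: s) <= open_value None (V (Some l :: s)))%R.
  exact: V_le_open.
have w_lel : (V (None :: Some l :: s) <= open_value (Some l) (V (None :: s)))%R.
  by rewrite (V_perm psw); apply: V_le_open.
have y_le3 : (V (None :: s) <= open_value None (V s))%R by apply: V_le_open.
have y_ge0 : (0 <= V (None :: s))%R by apply: V_ge0.
have x_ge0 : (0 <= V s)%R by apply: V_ge0.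
have [i Vi] := V_parity as_; have [j Vj] : exists j : int, V (None :: s) = (j * 2 + 1)%R.
  have [j ->] := @V_parity (None :: s) as_; exists j.
  by rewrite /= (count_memPn None_s).
rewrite (count_memPn None_s) addr0 in Vi.
have [l4 l_even] := andP ll.
have large m : m <= l -> all (is_loop_ge m) s.
  by move=> ml; apply/allP => c /mapP[z zks ->]; apply: leq_trans ml (allP min_l _ zks).
have x6 : 6 <= l -> s != [::] -> (2 <= V s)%R.
  move=> l6 s0; have := V_loops_ge s0 as_ (large 6 l6); lia.
have x8 : 8 <= l -> s != [::] -> (4 < V s)%R.
  move=> l8 s0; have := V_loops_ge s0 as_ (large 8 l8).
  have := V_large_loops as_ (large 8 l8); lia.
have s_nil : s = [::] -> V s = 0%R by move=> ->; exact: V_nil.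
(* An optimal opening in [K + 3] is either a loop of length at least 6, which alone costs 2, or the
   chain. *)
have y_large : 6 <= l -> (2 <= V (None :: s))%R \/ V (None :: s) = open_value None (V s).
  move=> l6; have [[k|] [t [pt _ _ ->]]] := @V_option (None :: s) isT as_; last first.
    by right; rewrite (@V_perm t s) // perm_sym -(perm_cons None).
  left; have := perm_mem pt (Some k); rewrite mem_head in_cons => /ge_l lek.
  by rewrite /open_value; move: (V t) => z; lia.
have [h l2h] : exists h, l = h * 2.
  by exists l./2; rewrite muln2 -[LHS]odd_double_half (negPf l_even).
have s_nonnil : s = [::] \/ s != [::] by case: (s) => [|? ?]; [left | right].
rewrite {}Vx in w_cases w_le3 *; move: w_cases w_le3 w_lel y_le3 y_ge0 x_ge0 Vi Vj x6 x8 s_nil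
  y_large; rewrite /open_value; move: (V (None :: Some l :: s)) (V (None :: s)) (V s).
(* From here on [x] is the value of [K], not of [H] as in the statement. *)
move=> w y x w_cases w_le3 w_lel y_le3 y_ge0 x_ge0 Vi Vj x6 x8 s_nil y_large.
case: s_nonnil => s0.
  (* With [K] empty, [x = 0] and [y] is 1 or 3, so opening [L] costs at most [l - 1], the price of
     the chain. *)
  by have {}s_nil := s_nil s0; clear -w_cases w_le3 w_lel y_le3 y_ge0 Vi Vj l2h l4 s_nil; split; lia.
have {}x6 := x6 ^~ s0; have {}x8 := x8 ^~ s0.
(* If [l >= 8], or [l = 6] and [x >= 6], then [x >= 6] and [3 <= y <= x - 1], so [L] is no worse
   than the chain. For [l = 6] the chain wins at [x = 2] and [x = 4]. For [l = 4] the chain costs 1,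
   the least odd cost, at [x = 2] and [x = 6]; for other [x], [L] is no worse. *)
by clear -w_cases w_le3 w_lel y_le3 y_ge0 x_ge0 Vi Vj l2h l4 x6 x8 y_large; split; lia.
Qed.
End LoonyEndgames.

Theorem theorem23 (ks : seq nat) (l : nat)
    (Hloops : all loop_length (l :: ks))
    (Hsmallest : all (leq l) ks) :
  let K := loops ks in
  let L := loop l in
  let H := union K L in
  let G := union H chain3 in
  [/\ v H = 2%:Z%R ->
        forall e : line chain3, @optimal_move G (inr e),
      v H <> 2%:Z%R -> l = 6 /\ v K = 2%:Z%R ->
        forall e : line chain3, @optimal_move G (inr e)
    & v H <> 2%:Z%R -> ~ (l = 6 /\ v K = 2%:Z%R) ->
        forall e : line L, @optimal_move G (inl (inr e))].
Proof.
rewrite loopsE => K L H G; set s := map Some ks; set V := fun t => v (components t).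
have EH : v H = V (Some l :: s).
  exact: v_iso (game_iso_swap _ _).
have as_ : all admissible s by move: Hloops; rewrite /= all_map => /andP[].
have ll : loop_length l by case/andP: Hloops.
(* Swaps both unions, turning [(K + L) + 3] into the order [3, L, K] used by [components]. *)
pose f : line G -> line (union chain3 (union L K)) := map_inr (@sum_swap _ _) \o @sum_swap _ _.
have iso_f : game_iso f.
  exact: game_iso_comp (game_iso_swap _ _) (game_iso_union _ (game_iso_swap _ _)).
have EG : v G = V (None :: Some l :: s).
  by rewrite -(v_iso iso_f).
have open3 (e : line chain3) : @v_move G (inr e) = open_value None (V (Some l :: s)).
  have aH : all admissible (Some l :: s) by rewrite /= ll.
  rewrite -(v_move_iso _ iso_f).
  exact: (@v_move_component None (Some l :: s) e isT aH).
have openL (e : line L) : @v_move G (inl (inr e)) = open_value (Some l) (V (None :: s)).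
  (* The further exchange brings [L] in front of the chain. *)
  rewrite -(v_move_iso _ iso_f) -(v_move_iso _ (game_iso_exchange _ _ _)).
  exact: (@v_move_component (Some l) (None :: s) e ll as_).
have [h2 h6 h] := opening_dichotomy Hloops Hsmallest.
rewrite /optimal_move EH EG; split.
- by move=> x2 e; rewrite open3; apply/esym/h2.
- by move=> x2 l6 e; rewrite open3; apply/esym/h6.
- by move=> x2 l6 e; rewrite openL; apply/esym/h.
Qed.
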